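(* Let $(\Omega,\mathcal F)$ be a measurable space, let $\mathcal P\subseteq\mathcal M_1$ be nonempty and arbitrary, and let $\mathcal Q\subseteq\mathcal M_1$ be nonempty and convex. Suppose there exist a joint information projection $(\mathsf P^*,\mathsf Q^* )$ and a random variable $X^*$ that is a $\mathsf P^*$-version of $d\mathsf Q^*/d\mathsf P^*$, such that $$\mathbb E_{\mathsf Q}[\log X^*]\ge\inf_{\mathsf R\in\mathcal Q}H(\mathsf R\mid\mathsf P^* )\qquad\text{for each }\mathsf Q\in\mathcal Q.$$ Then the corresponding e-variable $X^*$ is a GROW e-variable, which satisfies the strong duality $$\mathsf G=\sup_{X\in\mathcal E}\inf_{\mathsf Q\in\mathcal Q}\mathbb E_{\mathsf Q}[\log X]=\inf_{\mathsf Q\in\mathcal Q}\mathbb E_{\mathsf Q}[\log X^*]=\inf_{\mathsf Q\in\mathcal Q}H(\mathsf Q\mid\mathsf P^* )=\inf_{\mathsf Q\in\mathcal Q}\min_{\mathsf P\in\mathcal P_{\mathrm{eff}}}H(\mathsf Q\mid\mathsf P).$$ Further, if $\mathsf Q^*$ is an I-projection (i.e., $\mathsf Q^*\in\mathcal Q$), then $X^*$ is the $\mathsf P^*$-a.s. unique GROW e-variable.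
   Context: $\mathcal M_+$ and $\mathcal M_1$ are the sets of finite nonnegative (countably additive) measures and of probability measures on $\mathcal F$. An e-variable for $\mathcal P$ is a measurable $X:\Omega\to[0,\infty]$ with $\int X\,d\mathsf P\le1$ for all $\mathsf P\in\mathcal P$; $\mathcal E$ is the set of all e-variables. The effective null is $\mathcal P_{\mathrm{eff}}=\{\mathsf P\in\mathcal M_+:\int X\,d\mathsf P\le1\text{ for all }X\in\mathcal E\}$ (all its elements are sub-probabilities). Conventions: $\log0=-\infty$, $\log\infty=\infty$; $\mathbb E_{\mathsf Q}[\log X]=\mathbb E_{\mathsf Q}[(\log X)^+]-\mathbb E_{\mathsf Q}[(\log X)^-]$ if $\mathbb E_{\mathsf Q}[(\log X)^-]<\infty$, and $=-\infty$ if $\mathbb E_{\mathsf Q}[(\log X)^-]=\infty$. For $\mathsf Q\in\mathcal M_1$, $\mathsf P\in\mathcal M_+$: $H(\mathsf Q\mid\mathsf P)=\int\log(d\mathsf Q/d\mathsf P)\,d\mathsf Q$ if $\mathsf Q\ll\mathsf P$ and $=\infty$ otherwise. Reverse information projection (RIPr): for $\mathsf Q\in\mathcal M_1$ the numeraire $X^{\mathrm{num}}$ is the log-optimal e-variable for $\mathcal P$ against $\mathsf Q$: the ($\mathsf Q$-a.s. unique, known to exist) e-variable that is $\mathsf Q$-a.s. strictly positive and satisfies $\mathbb E_{\mathsf Q}[X/X^{\mathrm{num}}]\le1$ for all $X\in\mathcal E$ (with $x/\infty=0$ for $x<\infty$ and $\infty/\infty=1$). The RIPr of $\mathsf Q$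 onto $\mathcal P_{\mathrm{eff}}$ is the sub-probability measure with $\mathsf Q$-density $1/X^{\mathrm{num}}$; it belongs to $\mathcal P_{\mathrm{eff}}$. Generalized I-projection (GIPr): for a probability measure $\mathsf P$ and convex $\mathcal Q$ with $\inf_{\mathsf Q\in\mathcal Q}H(\mathsf Q\mid\mathsf P)<\infty$, the GIPr of $\mathsf P$ onto $\mathcal Q$ is the unique probability measure $\mathsf Q'$ (known to exist, not necessarily in $\mathcal Q$) with $H(\mathsf Q\mid\mathsf Q')+\inf_{\mathsf R\in\mathcal Q}H(\mathsf R\mid\mathsf P)\le H(\mathsf Q\mid\mathsf P)$ for all $\mathsf Q\in\mathcal Q$. For a nonzero sub-probability $\mathsf P$, the GIPr is that of $\mathsf P/\mathsf P(\Omega)$. It is called an I-projection if it belongs to $\mathcal Q$, in which case it achieves $\inf_{\mathsf Q\in\mathcal Q}H(\mathsf Q\mid\mathsf P)$. It always lies in $\overline{\mathcal Q}^I=\{\mathsf R\in\mathcal M_1:\inf_{\mathsf Q\in\mathcal Q}H(\mathsf Q\mid\mathsf R)=0\}$. Joint information projection (JIPr): a pair $(\mathsf P^*,\mathsf Q^* )\in\mathcal M_+\times\mathcal M_1$ such that (i) $\mathsf P^*\in\mathcal P_{\mathrm{eff}}$ is the RIPr of $\mathsf Q^*$ onto $\mathcal P_{\mathrm{eff}}$; (ii) $\inf_{\mathsf Q\in\mathcal Q}H(\mathsf Q\mid\mathsf P^* )<\infty$ and $\mathsf Q^*\in\overline{\mathcal Q}^I$ is the GIPr of $\mathsf P^*$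 onto $\mathcal Q$. A ''$\mathsf P^*$-version'' of $d\mathsf Q^*/d\mathsf P^*$ is a $[0,\infty]$-valued measurable function that is $\mathsf P^*$-a.s. equal to this density. A GROW e-variable is an $X\in\mathcal E$ with $\inf_{\mathsf Q\in\mathcal Q}\mathbb E_{\mathsf Q}[\log X]=\mathsf G$, where $\mathsf G=\sup_{X\in\mathcal E}\inf_{\mathsf Q\in\mathcal Q}\mathbb E_{\mathsf Q}[\log X]$.
   Formalization: The formal theorem additionally assumes that the chosen P*-version X* of dQ*/dP* is an e-variable; an arbitrary P*-version can be infinite off the support of P* and then fail to be an e-variable, making the literal claim false. *)

(* Defs.v *)
From HB Require Import structures.
From mathcomp Require Import all_boot all_order all_algebra.
From mathcomp Require Import all_classical all_reals all_analysis.
From mathcomp Require Import measurable_realfun.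

Set Implicit Arguments.
Unset Strict Implicit.
Unset Printing Implicit Defensive.

Import Order.TTheory GRing.Theory Num.Theory.
Import numFieldNormedType.Exports.

Local Open Scope classical_set_scope.
Local Open Scope ring_scope.
Local Open Scope ereal_scope.
Local Open Scope charge_scope.

(** A measure of the library is a function on all subsets of [T] of which only
    the values on measurable sets are meaningful, so membership of a measure in
    a set of probabilities is taken up to agreement on measurable sets. *)
Definition mem_proba d (T : measurableType d) (R : realType)
    (QQ : set (probability T R)) (mu : set T -> \bar R) : Prop :=
  exists2 Q : probability T R, QQ Q & forall A, measurable A -> mu A = Q A.

Definition convex_proba d (T : measurableType d) (R : realType)
    (QQ : set (probability T R)) : Prop :=
  forall (Q0 Q1 : probability T R) (t : R), QQ Q0 -> QQ Q1 ->
    (0 <= t <= 1)%R ->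
    mem_proba QQ (fun A => t%:E * Q0 A + (1 - t)%:E * Q1 A).

Definition e_variable d (T : measurableType d) (R : realType)
    (PP : set (probability T R)) (X : T -> \bar R) : Prop :=
  [/\ measurable_fun [set: T] X,
      forall x, 0 <= X x
    & forall P : probability T R, PP P -> \int[P]_x X x <= 1].

Definition effective_null d (T : measurableType d) (R : realType)
    (PP : set (probability T R)) : set {finite_measure set T -> \bar R} :=
  [set P | forall X, e_variable PP X -> \int[P]_x X x <= 1].

(** In [\bar R] one has [+oo - +oo = -oo], so the integral of [lne \o X], which
    is the integral of the positive part minus that of the negative part, is
    [-oo] as soon as the negative part has infinite integral. *)
Definition expected_log d (T : measurableType d) (R : realType)
    (Q : probability T R) (X : T -> \bar R) : \bar R :=
  \int[Q]_x lne (X x).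

Definition density d (T : measurableType d) (R : realType)
    (Q : probability T R) (P : {finite_measure set T -> \bar R}) : T -> \bar R :=
  'd (charge_of_finite_measure Q) '/d P.

Definition rel_entropy d (T : measurableType d) (R : realType)
    (Q : probability T R) (P : {finite_measure set T -> \bar R}) : \bar R :=
  if `[< Q `<< P >] then expected_log Q (density Q P) else +oo.

Definition inf_entropy d (T : measurableType d) (R : realType)
    (QQ : set (probability T R)) (P : {finite_measure set T -> \bar R}) : \bar R :=
  ereal_inf [set rel_entropy Q P | Q in QQ].

(** Division with [x / +oo = 0] for [x < +oo] and [+oo / +oo = 1] (the library
    has [+oo / +oo = 0]). *)
Definition eratio (R : realType) (x y : \bar R) : \bar R :=
  if (x == +oo) && (y == +oo) then 1 else x / y.

Definition numeraire d (T : measurableType d) (R : realType)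
    (PP : set (probability T R)) (Q : probability T R) (X : T -> \bar R) : Prop :=
  [/\ e_variable PP X,
      {ae Q, forall x, 0 < X x}
    & forall Y, e_variable PP Y -> \int[Q]_x eratio (Y x) (X x) <= 1].

(** Since the numeraire is unique up to [Q]-null sets, so is its inverse, and
    the existential determines [P] on measurable sets. *)
Definition is_ripr d (T : measurableType d) (R : realType)
    (PP : set (probability T R)) (Q : probability T R)
    (P : {finite_measure set T -> \bar R}) : Prop :=
  exists2 X : T -> \bar R, numeraire PP Q X &
    forall A, measurable A -> P A = \int[Q]_(x in A) (X x)^-1.

Definition is_gipr_proba d (T : measurableType d) (R : realType)
    (QQ : set (probability T R)) (P Q' : probability T R) : Prop :=
  inf_entropy QQ P < +oo /\
  forall Q : probability T R, QQ Q ->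
    rel_entropy Q Q' + inf_entropy QQ P <= rel_entropy Q P.

(** The last argument of [mnormalize] is a default value used only when the
    total mass is [0] or [+oo], which is excluded here. *)
Definition is_gipr d (T : measurableType d) (R : realType)
    (QQ : set (probability T R)) (P : {finite_measure set T -> \bar R})
    (Q' : probability T R) : Prop :=
  0 < P [set: T] /\ is_gipr_proba QQ (mnormalize P Q') Q'.

Definition I_closure d (T : measurableType d) (R : realType)
    (QQ : set (probability T R)) : set (probability T R) :=
  [set R' | inf_entropy QQ R' = 0].

Definition is_jipr d (T : measurableType d) (R : realType)
    (PP QQ : set (probability T R)) (P : {finite_measure set T -> \bar R})
    (Q : probability T R) : Prop :=
  [/\ effective_null PP P, is_ripr PP Q P, inf_entropy QQ P < +oo,
      I_closure QQ Q & is_gipr QQ P Q].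

Definition density_version d (T : measurableType d) (R : realType)
    (Q : probability T R) (P : {finite_measure set T -> \bar R})
    (X : T -> \bar R) : Prop :=
  [/\ measurable_fun [set: T] X,
      forall x, 0 <= X x
    & {ae P, forall x, X x = density Q P x}].

Definition inf_expected_log d (T : measurableType d) (R : realType)
    (QQ : set (probability T R)) (X : T -> \bar R) : \bar R :=
  ereal_inf [set expected_log Q X | Q in QQ].

Definition grow_value d (T : measurableType d) (R : realType)
    (PP QQ : set (probability T R)) : \bar R :=
  ereal_sup [set inf_expected_log QQ X | X in e_variable PP].

Definition is_grow d (T : measurableType d) (R : realType)
    (PP QQ : set (probability T R)) (X : T -> \bar R) : Prop :=
  e_variable PP X /\ inf_expected_log QQ X = grow_value PP QQ.

Definition min_entropy_attained d (T : measurableType d) (R : realType)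
    (PP : set (probability T R)) (Q : probability T R) : Prop :=
  exists2 P : {finite_measure set T -> \bar R}, effective_null PP P &
    forall P', effective_null PP P' -> rel_entropy Q P <= rel_entropy Q P'.

Definition min_entropy d (T : measurableType d) (R : realType)
    (PP : set (probability T R)) (Q : probability T R) : \bar R :=
  ereal_inf [set rel_entropy Q P | P in effective_null PP].

(* Main.v *)
Require Import Defs.
From HB Require Import structures.
From mathcomp Require Import all_boot all_order all_algebra.
From mathcomp Require Import all_classical all_reals all_analysis.
From mathcomp Require Import measurable_realfun.
From mathcomp Require Import ring lra.

Import Order.TTheory GRing.Theory Num.Theory.
Import numFieldNormedType.Exports.

Set Implicit Arguments.
Unset Strict Implicit.
Unset Printing Implicit Defensive.

Local Open Scope classical_set_scope.
Local Open Scope ring_scope.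
Local Open Scope ereal_scope.

(** Duality. If [Q] has density [e^(-x)] with respect to [P], then integrating
    the pointwise bound [ln z <= z e^x - 1 - x] at [z = Z t] gives Gibbs'
    inequality [E_Q (ln Z) + 1 <= H(Q|P) + E_P Z] (lemma [gibbs]). For an
    e-variable [X] and an effective null [P] one has [E_P X <= 1], so
    [E_Q (ln X) <= H(Q|P)]. Hence every e-variable has worst-case expected
    logarithm at most [inf_Q H(Q|Ps)], while [Xs] reaches this value by
    assumption. All the suprema and infima of the strong duality are squeezed
    between these two bounds.

    Uniqueness. Let [X] and [Xs] both have expected logarithm at least [G]
    under every [Q] in [QQ]. So does their geometric mean [Z], as [ln Z] is
    the average of the two logarithms. Gibbs' inequality applied to [Z] reads
    [G <= H(Q|Ps) + E_Ps Z - 1]; the infimum over [Q] of the right-hand side is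
    [G + E_Ps Z - 1], and [G] is finite, so [1 <= E_Ps Z]. But
    [E_Ps Z <= E_Ps ((X + Xs) / 2) <= 1], so the arithmetic-geometric
    inequality is almost surely an equality, that is [X = Xs]
    (lemma [eq_of_expected_log_ge_inf_entropy]).

    Attainment of [min_P H(Q|P)]. When this minimum is finite, minimizing
    [H(Q|P)] over the effective null amounts to maximizing [E_Q x] over the
    log-densities [x] such that [E_Q (X e^x) <= 1] for all e-variables [X].
    This set contains the logarithm of the average of [e^x] and [e^y] as soon
    as it contains [x] and [y]. The expectation of that logarithm exceeds the
    average of [E_Q x] and [E_Q y] by an amount which controls [E_Q |x - y|]
    (lemma [dist_le_log_mean]), so a maximizing sequence is Cauchy in
    [L1(Q)]. Its limit is again in the set by Fatou's lemma, because
    e-variables are nonnegative, and it is a maximizer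
    (lemma [log_polar_maximizer]). *)

(** * Convexity of the log-sum-exp function *)

Lemma ln_le_sub1 (R : realType) (z : R) : (0 < z -> ln z <= z - 1)%R.
Proof.
move=> z0; have -> : (ln z = ln (1 + (z - 1)))%R by congr ln; ring.
by apply: le_ln1Dx; lra.
Qed.

Lemma ge_ln_1subV (R : realType) (z : R) : (0 < z -> 1 - z^-1 <= ln z)%R.
Proof.
move=> z0; have zV0 : (0 < z^-1)%R by rewrite invr_gt0.
by have := ln_le_sub1 zV0; rewrite lnV ?posrE//; lra.
Qed.

(** With [v = u / 2] the excess [cosh u - 1] is half of the square of
    [e^v - e^(-v)], which is at least [v] for nonnegative [v]. *)
Lemma cosh_ge_sqr (R : realType) (u : R) :
  (1 + u ^+ 2 / 8 <= (expR u + expR (- u)) / 2)%R.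
Proof.
wlog u0 : u / (0 <= u)%R => [wh|].
  have [|u0] := leP 0%R u; first exact: wh.
  by have := wh (- u)%R; rewrite opprK sqrrN [(expR u + _)%R]addrC; apply; lra.
set v := (u / 2)%R.
have uv : (u = v + v)%R by rewrite /v; lra.
have v0 : (0 <= v)%R by rewrite /v; lra.
have h1 : (v <= expR v - expR (- v))%R.
  have := expR_ge1Dx v; have : (expR (- v) <= 1)%R by rewrite expR_le1; lra.
  lra.
have h2 : (expR v * expR (- v) = 1)%R by exact: expRxMexpNx_1.
rewrite uv opprD !expRD.
have h3 : (v * v <= (expR v - expR (- v)) * (expR v - expR (- v)))%R.
  by apply: ler_pM.
nra.
Qed.

Definition log_mean (R : realType) (a b : R) : R :=
  ln ((expR a + expR b) / 2).

Lemma expR_log_mean (R : realType) (a b : R) :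
  expR (log_mean a b) = ((expR a + expR b) / 2)%R.
Proof.
rewrite /log_mean lnK// posrE divr_gt0// addr_gt0 ?expR_gt0//.
Qed.

(** The Jensen gap of the exponential equals [ln (cosh u)], [u = (a - b) / 2].
    It grows like [u^2] near [0] and like [|u|] at infinity; the free parameter
    [e] turns the quadratic regime into a linear bound, as
    [2 |u| <= e + u^2 / e]. *)
Lemma dist_le_log_mean (R : realType) (a b e : R) : (0 < e <= 1)%R ->
  (`|a - b| <= e + 12 / e * (log_mean a b - (a + b) / 2))%R.
Proof.
move=> /andP[e0 e1].
set h := (_ - _ / 2)%R; set u := ((a - b) / 2)%R.
have hE : (h = ln ((expR u + expR (- u)) / 2))%R.
  apply: expR_inj; rewrite /h expRB expR_log_mean lnK; last first.
    by rewrite posrE divr_gt0// addr_gt0 ?expR_gt0//.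
  set w := ((a + b) / 2)%R.
  have ea : (a = u + w)%R by rewrite /u /w; field.
  have eb : (b = - u + w)%R by rewrite /u /w; field.
  rewrite [in expR a]ea [in expR b]eb.
  rewrite !expRD; have := expR_gt0 w; move: (expR w) => c c0.
  by field; rewrite gt_eqF.
have -> : (`|a - b| = 2 * `|u|)%R.
  by rewrite /u normrM [(`|2^-1|)%R]ger0_norm ?invr_ge0//; lra.
have hN : h = ln ((expR `|u| + expR (- `|u|)) / 2)%R.
  rewrite hE; have [u0|u0] := leP 0%R u; first by rewrite ger0_norm.
  by rewrite ltr0_norm// opprK addrC.
move: hN (normr_ge0 u); move: h {hE} (`|u|)%R => h {}u hE u0.
(* The quadratic regime is taken up to 2, past which ln 2 <= 1 <= u / 2. *)
have [u2|u2] := leP u 2%R.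
  have h1 : (u ^+ 2 / 12 <= h)%R.
    have cu := cosh_ge_sqr u.
    have c0 : (0 < 1 + u ^+ 2 / 8)%R by rewrite ltr_wpDr// divr_ge0// sqr_ge0.
    rewrite hE; apply: (@le_trans _ _ (ln (1 + u ^+ 2 / 8))%R); last first.
      by rewrite ler_ln// posrE (lt_le_trans c0).
    apply: le_trans (ge_ln_1subV c0).
    have u24 : (u ^+ 2 <= 4)%R by rewrite expr2; nra.
    have u20 := sqr_ge0 u.
    move: (u ^+ 2)%R c0 u24 u20 => s c0 s4 s0.
    have -> : (1 - (1 + s / 8)^-1 = (s / 8) / (1 + s / 8))%R by field; lra.
    rewrite ler_pdivlMr//; nra.
  have h2 : (u ^+ 2 / e <= 12 / e * h)%R.
    rewrite -[X in (_ <= X)%R]mulrAC ler_pM2r ?invr_gt0//; lra.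
  have h3 : (2 * u <= e + u ^+ 2 / e)%R.
    have -> : (e + u ^+ 2 / e = ((e - u) ^+ 2) / e + 2 * u)%R.
      by field; rewrite gt_eqF.
    by rewrite lerDr divr_ge0 ?sqr_ge0// ltW.
  by apply: le_trans h3 _; rewrite lerD2l.
have h1 : (u / 2 <= h)%R.
  have h2 : (0 < expR u / 2)%R by rewrite divr_gt0 ?expR_gt0.
  apply: (@le_trans _ _ (ln (expR u / 2))%R); last first.
    rewrite hE ler_ln ?posrE//; last by rewrite divr_gt0// addr_gt0 ?expR_gt0.
    by have := expR_gt0 (- u)%R; lra.
  rewrite ln_div ?posrE ?expR_gt0// expRK.
  have := @ln_le_sub1 R 2%R; lra.
have h2 : (12 * h <= 12 / e * h)%R.
  apply: ler_wpM2r; first lra.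
  by rewrite ler_pdivlMr//; lra.
lra.
Qed.

(** * Integrals of measurable extended-real functions *)

Lemma measurable_lne (R : realType) : measurable_fun [set: \bar R] (@lne R).
Proof.
have -> : @lne R = fun x => if x <= 0 then -oo else
    if x == +oo then +oo else (ln (fine x))%:E.
  by apply/funext => -[r| |]/=; rewrite ?leNye ?(lee_fin r 0).
apply: measurable_fun_ifT => //=.
  exact: measurable_fun_lee.
apply: measurable_fun_ifT => //=; first exact: measurable_fun_eqe.
by apply/measurable_EFinP; exact: measurableT_comp.
Qed.

Section integral_comparison.
Context d (T : measurableType d) (R : realType).
Variable mu : {measure set T -> \bar R}.

(** Both sides are differences of the integrals of a positive and a negative
    part, and the convention [+oo - +oo = -oo] keeps subtraction monotone. *)
Lemma le_integral_measurable (f g : T -> \bar R) :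
  measurable_fun [set: T] f -> measurable_fun [set: T] g ->
  (forall x, f x <= g x) -> \int[mu]_x f x <= \int[mu]_x g x.
Proof.
move=> mf mg fg; rewrite integralE [leRHS]integralE; apply: leeB.
- apply: ge0_le_integral => //; [exact: measurable_funepos..|].
  by move=> x _; apply: (@funepos_le _ _ setT); rewrite ?inE.
- apply: ge0_le_integral => //; [exact: measurable_funeneg..|].
  by move=> x _; apply: (@funeneg_le _ _ setT); rewrite ?inE.
Qed.

Lemma ae_le_integral_measurable (f g : T -> \bar R) :
  measurable_fun [set: T] f -> measurable_fun [set: T] g ->
  {ae mu, forall x, f x <= g x} -> \int[mu]_x f x <= \int[mu]_x g x.
Proof.
move=> mf mg fg.
have -> : \int[mu]_x g x = \int[mu]_x maxe (f x) (g x).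
  apply: ae_eq_integral => //; first exact: measurable_maxe.
  by apply: filterS fg => x fg _; apply/esym/max_idPr.
apply: le_integral_measurable => //; first exact: measurable_maxe.
by move=> x; rewrite le_max lexx.
Qed.

Lemma fin_num_integral_integrable (f : T -> \bar R) :
  measurable_fun [set: T] f -> \int[mu]_x f x \is a fin_num ->
  mu.-integrable [set: T] f.
Proof.
move=> mf fi; apply/integrableP; split => //.
by apply/abse_integralP => //; rewrite ltey_eq abse_fin_num fi.
Qed.

End integral_comparison.

(** * Densities *)

Section densities.
Context d (T : measurableType d) (R : realType).

Lemma ge0_integral_density (P Q : {finite_measure set T -> \bar R})
    (f Z : T -> \bar R) :
  measurable_fun [set: T] f -> (forall x, 0 <= f x) ->
  (forall A, measurable A -> P A = \int[Q]_(x in A) f x) ->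
  measurable_fun [set: T] Z -> (forall x, 0 <= Z x) ->
  \int[P]_x Z x = \int[Q]_x (Z x * f x).
Proof.
move=> mf f0 PE mZ Z0.
have PQ : P `<< Q.
  apply/null_content_dominatesP => A mA QA0.
  by rewrite PE// null_set_integral//; exact: measurable_funTS.
rewrite -(Radon_Nikodym_SigmaFinite.change_of_variables PQ Z0)//.
set g := Radon_Nikodym_SigmaFinite.f P Q.
have gi : Q.-integrable setT g by exact: Radon_Nikodym_SigmaFinite.f_integrable.
apply: ge0_ae_eq_integral => //.
- by apply: emeasurable_funM => //; exact: measurable_int gi.
- exact: emeasurable_funM.
- by move=> x _; rewrite mule_ge0// Radon_Nikodym_SigmaFinite.f_ge0.
- by move=> x _; rewrite mule_ge0.
- apply: ae_eqe_mul2l; apply: integral_ae_eq => // A _ mA.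
  by rewrite -PE// -Radon_Nikodym_SigmaFinite.f_integral.
Qed.

(** A real-valued version [x] of [- ln (dQ/dP)]. The last conclusion is an
    inequality because [e^x Q] is only the part of [P] that is absolutely
    continuous with respect to [Q]; with [Z = 1] it bounds the integral of the
    positive part of [x], so that finite entropy makes [x] integrable. *)
Lemma neg_log_density (Q : probability T R)
    (P : {finite_measure set T -> \bar R}) : rel_entropy Q P < +oo ->
  exists x : T -> R, [/\ Q.-integrable [set: T] (EFin \o x),
    rel_entropy Q P = - \int[Q]_t (x t)%:E
    & forall Z : T -> \bar R, measurable_fun [set: T] Z ->
      (forall t, 0 <= Z t) ->
      \int[Q]_t (Z t * (expR (x t))%:E) <= \int[P]_t Z t].
Proof.
rewrite /rel_entropy; case: asboolP => [QP|]; last by rewrite ltxx.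
pose q := Radon_Nikodym_SigmaFinite.f Q P.
have q0 t : 0 <= q t by exact: Radon_Nikodym_SigmaFinite.f_ge0.
have qi : P.-integrable setT q by exact: Radon_Nikodym_SigmaFinite.f_integrable.
have mq : measurable_fun [set: T] q by exact: measurable_int qi.
pose r t := fine (q t).
have qE t : q t = (r t)%:E.
  by rewrite /r fineK// Radon_Nikodym_SigmaFinite.f_fin_num.
have r0 t : (0 <= r t)%R by rewrite -lee_fin -qE.
have mr : measurable_fun [set: T] r by exact: measurableT_comp.
pose x t := (- ln (r t))%R.
have mx : measurable_fun [set: T] x by do 2 apply: measurableT_comp => //.
have mex : measurable_fun [set: T] (fun t => (expR (x t))%:E).
  by apply/measurable_EFinP; apply: measurableT_comp.
(* If r t = 0 then ln (r t) = 0, so e^x * r is 0 or 1 everywhere. *)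
have change (Z : T -> \bar R) : measurable_fun [set: T] Z ->
    (forall t, 0 <= Z t) ->
    \int[Q]_t (Z t * (expR (x t))%:E) <= \int[P]_t Z t.
  move=> mZ Z0.
  have Zex0 t : 0 <= Z t * (expR (x t))%:E.
    by rewrite mule_ge0// lee_fin expR_ge0.
  rewrite -(Radon_Nikodym_SigmaFinite.change_of_variables QP Zex0)//; last first.
    exact: emeasurable_funM.
  apply: ge0_le_integral => //.
  - by move=> t _; exact: mule_ge0.
  - by do 2 apply: emeasurable_funM => //.
  - move=> t _; rewrite -/q qE -muleA -EFinM /x.
    have := r0 t; rewrite le_eqVlt => /predU1P[<-|rt].
      by rewrite mulr0 mule0.
    by rewrite expRN lnK ?posrE// mulVf ?mule1// gt_eqF.
have lneE : {ae Q, forall t, lne (density Q P t) = (- x t)%:E}.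
  have Qr0 : Q.-negligible [set t | r t = 0%R].
    have mA : measurable [set t | r t = 0%R].
      rewrite (_ : mkset _ = r @^-1` [set 0%R])// -[_ @^-1` _]setTI.
      exact: mr.
    apply/negligibleP => //.
    rewrite [LHS](Radon_Nikodym_SigmaFinite.f_integral QP)//.
    by apply: integral0_eq => t /= rt; rewrite -/q qE rt.
  have Qqd : ae_eq Q setT q (density Q P).
    apply: (null_dominates_ae_eq _ QP) => //.
    exact: ae_eq_Radon_Nikodym_SigmaFinite.
  have {}Qr0 : {ae Q, forall t, r t <> 0%R}.
    by apply: negligibleS Qr0 => t /=; rewrite not_notP.
  apply: filterS2 Qr0 Qqd => t rt <-//; rewrite qE lne_EFin ?/x ?opprK//.
  by rewrite lt_neqAle r0 andbT eq_sym; apply/eqP.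
have -> : expected_log Q (density Q P) = \int[Q]_t (- x t)%:E.
  apply: ae_eq_integral => //.
  - apply: measurableT_comp; first exact: measurable_lne.
    by apply: (measurable_int P); exact: Radon_Nikodym_integrable.
  - by apply/measurable_EFinP; exact: measurableT_comp.
  - by apply: filterS lneE => t -> _.
have mxE : measurable_fun [set: T] (EFin \o x) by exact/measurable_EFinP.
have xp : \int[Q]_t (EFin \o x)^\+ t < +oo.
  apply: (@le_lt_trans _ _ (P setT)); last by rewrite ltey_eq fin_num_measure.
  rewrite -[P setT]mul1e -integral_cst//.
  apply: le_trans (change (cst 1) _ _) => //.
  apply: ge0_le_integral => //; first exact: measurable_funepos.
  - by apply: emeasurable_funM.
  - move=> t _; rewrite funeposE ge_max mul1e !lee_fin expR_ge0 andbT.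
    by have := expR_ge1Dx (x t); lra.
have -> : \int[Q]_t (- x t)%:E = - \int[Q]_t (x t)%:E.
  rewrite -integralN//=; apply: fin_num_adde_defr.
  by rewrite ge0_fin_numE// integral_ge0.
move=> xy; exists x; split => //.
have xm : \int[Q]_t (EFin \o x)^\- t < +oo.
  move: xy; rewrite [X in - X]integralE; rewrite ltey => xy.
  rewrite ltey; apply: contra xy => /eqP ->.
  have : \int[Q]_t (EFin \o x)^\+ t \is a fin_num.
    by rewrite ge0_fin_numE// integral_ge0.
  by move=> /fineK <-.
apply/integrableP; split => //.
under eq_integral => t _ do rewrite -/((abse \o (EFin \o x)) t) fune_abse.
rewrite ge0_integralD//; [exact: lte_add_pinfty| |].
- exact: measurable_funepos.
- exact: measurable_funeneg.
Qed.

End densities.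

(** * Gibbs' inequality and weak duality *)

Section gibbs.
Context d (T : measurableType d) (R : realType).
Variables (Q : probability T R) (P : {finite_measure set T -> \bar R}).

Lemma lne_le_mul_expR (z : \bar R) (x : R) : 0 <= z ->
  lne z <= z * (expR x)%:E - (1 + x)%:E.
Proof.
case: z => [z| |]//; rewrite ?lee_fin => z0; last first.
  by rewrite gt0_mulye ?lte_fin ?expR_gt0// addye.
have := z0; rewrite le_eqVlt => /predU1P[<-|zp].
  by rewrite le0_lneNy// leNye.
rewrite lne_EFin// -EFinM -EFinB lee_fin.
have := @ln_le_sub1 R (z * expR x)%R; rewrite lnM ?posrE ?expR_gt0// expRK.
by move=> /(_ (mulr_gt0 zp (expR_gt0 x))); lra.
Qed.

(** Stating the inequality without a logarithm of [E_P Z] keeps the case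
    [E_P Z = 0] uniform and makes it linear in [E_P Z]. *)
Lemma gibbs (Z : T -> \bar R) : measurable_fun [set: T] Z ->
  (forall t, 0 <= Z t) -> \int[P]_t Z t < +oo ->
  expected_log Q Z + 1 <= rel_entropy Q P + \int[P]_t Z t.
Proof.
move=> mZ Z0 Zy.
have PZ0 : 0 <= \int[P]_t Z t by exact: integral_ge0.
have PZ : \int[P]_t Z t \is a fin_num by rewrite ge0_fin_numE.
have [|H] := eqVneq (rel_entropy Q P) +oo.
  by move=> ->; rewrite addye ?leey// gt_eqF// (lt_le_trans _ PZ0).
have {}H : rel_entropy Q P < +oo by rewrite ltey.
have [x [ix -> dx]] := neg_log_density H.
have mx : measurable_fun [set: T] x.
  by apply/measurable_EFinP; exact: measurable_int ix.
set I := \int[Q]_t (x t)%:E.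
have fI : I \is a fin_num by exact: integrable_fin_num.
pose F t := Z t * (expR (x t))%:E.
have mF : measurable_fun [set: T] F.
  apply: emeasurable_funM => //.
  by apply/measurable_EFinP; exact: measurableT_comp.
have F0 t : 0 <= F t by rewrite mule_ge0// lee_fin expR_ge0.
have FI : \int[Q]_t F t <= \int[P]_t Z t by exact: dx.
have iF : Q.-integrable [set: T] F.
  apply/integrableP; split => //.
  under eq_integral do rewrite gee0_abs//.
  exact: le_lt_trans FI Zy.
have i1 : Q.-integrable [set: T] (fun t => (1 + x t)%:E).
  rewrite (_ : (fun _ => _) = cst 1 \+ (EFin \o x)); last by apply/funext.
  apply: integrableD => //; exact: finite_measure_integrable_cst.
have : expected_log Q Z <= \int[Q]_t F t - (1 + I).
  apply: (@le_trans _ _ (\int[Q]_t (F t - (1 + x t)%:E))).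
    apply: le_integral_measurable; last by move=> t; exact: lne_le_mul_expR.
    - by apply: measurableT_comp => //; exact: measurable_lne.
    - by apply: emeasurable_funB => //; exact: measurable_int i1.
  rewrite integralB//; apply: leeB => //.
  rewrite (_ : (fun t => (1 + x t)%:E) = cst 1 \+ (EFin \o x)); last exact/funext.
  rewrite integralD//; last exact: finite_measure_integrable_cst.
  have -> : \int[Q]_t cst 1 t = 1.
    by rewrite integral_cst// mul1e; exact: probability_setT.
  exact: lexx.
move=> /le_trans/(_ (leeB FI (lexx _))).
move: (expected_log Q Z) => E; rewrite -(fineK PZ) -(fineK fI).
by case: E => [e| |]; rewrite ?leNye// -!EFinD ?lee_fin//; lra.
Qed.
End gibbs.

Lemma expected_log_le_rel_entropy d (T : measurableType d) (R : realType)
    (Q : probability T R) (P : {finite_measure set T -> \bar R}) X :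
  measurable_fun [set: T] X -> (forall t, 0 <= X t) -> \int[P]_t X t <= 1 ->
  expected_log Q X <= rel_entropy Q P.
Proof.
move=> mX X0 X1; rewrite -(@leeD2rE _ 1)//.
apply: le_trans (leeD (lexx _) X1); apply: gibbs => //.
exact: le_lt_trans X1 (ltry _).
Qed.

(** * Uniqueness by geometric means *)

Section uniqueness.
Context d (T : measurableType d) (R : realType).
Variables (P : {finite_measure set T -> \bar R}) (X Y : T -> \bar R).
Hypotheses (mX : measurable_fun [set: T] X) (mY : measurable_fun [set: T] Y).
Hypotheses (X0 : forall t, 0 <= X t) (Y0 : forall t, 0 <= Y t).
Hypotheses (X1 : \int[P]_t X t <= 1) (Y1 : \int[P]_t Y t <= 1).

Definition geo_mean t : R := Num.sqrt (fine (X t) * fine (Y t)).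

Lemma measurable_geo_mean : measurable_fun [set: T] (EFin \o geo_mean).
Proof.
apply/measurable_EFinP.
apply: (@measurableT_comp _ _ _ _ _ _ (@Num.sqrt R)).
  by apply: continuous_measurable_fun; exact: sqrt_continuous.
by apply: measurable_funM; exact: measurableT_comp.
Qed.

Let iX : P.-integrable [set: T] X.
Proof.
apply/integrableP; split => //; under eq_integral do rewrite gee0_abs//.
exact: le_lt_trans X1 (ltry _).
Qed.

Let iY : P.-integrable [set: T] Y.
Proof.
apply/integrableP; split => //; under eq_integral do rewrite gee0_abs//.
exact: le_lt_trans Y1 (ltry _).
Qed.

Let finXY : {ae P, forall t, X t \is a fin_num /\ Y t \is a fin_num}.
Proof.
have hX := integrable_ae measurableT iX; have hY := integrable_ae measurableT iY.
by apply: filterS2 hX hY => t hX hY; split; [exact: hX|exact: hY].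
Qed.

Lemma expected_log_geo_mean (Q : probability T R) (g : R) :
  rel_entropy Q P < +oo ->
  g%:E <= expected_log Q X -> g%:E <= expected_log Q Y ->
  g%:E <= expected_log Q (EFin \o geo_mean).
Proof.
move=> H gX gY.
have QP : Q `<< P.
  by apply: contrapT => QP; move: H; rewrite /rel_entropy asboolF// ltxx.
have mlX : measurable_fun [set: T] (fun t => lne (X t)).
  by apply: measurableT_comp => //; exact: measurable_lne.
have mlY : measurable_fun [set: T] (fun t => lne (Y t)).
  by apply: measurableT_comp => //; exact: measurable_lne.
have ilX : Q.-integrable [set: T] (fun t => lne (X t)).
  apply: fin_num_integral_integrable => //.
  rewrite fin_numElt (lt_le_trans _ gX) ?ltNyr//=.
  exact: le_lt_trans (expected_log_le_rel_entropy _ _ _ _) H.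
have ilY : Q.-integrable [set: T] (fun t => lne (Y t)).
  apply: fin_num_integral_integrable => //.
  rewrite fin_numElt (lt_le_trans _ gY) ?ltNyr//=.
  exact: le_lt_trans (expected_log_le_rel_entropy _ _ _ _) H.
have ilXY := integrableD measurableT ilX ilY.
have finQ : {ae Q, forall t, X t \is a fin_num /\ Y t \is a fin_num}.
  have [A [mA A0 sA]] := finXY; exists A; split => //.
  by move/null_content_dominatesP : QP; apply.
apply: (@le_trans _ _ (\int[Q]_t (2^-1%:E * (lne (X t) + lne (Y t))))).
  rewrite integralZl// integralD//.
  apply: (@le_trans _ _ (2^-1%:E * (g%:E + g%:E))).
    by rewrite -EFinD -EFinM lee_fin; lra.
  by apply: lee_wpmul2l; [rewrite lee_fin invr_ge0|exact: leeD].
apply: ae_le_integral_measurable.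
- by apply: emeasurable_funM => //; exact: emeasurable_funD.
- by apply: measurableT_comp; [exact: measurable_lne|exact: measurable_geo_mean].
- apply: filterS finQ => t [+ +]; rewrite -[(EFin \o _) t]/(geo_mean t)%:E.
  move: (X0 t) (Y0 t); rewrite /geo_mean.
  case: (X t) => [a| |]//; case: (Y t) => [b| |]//.
  rewrite -[fine a%:E]/a -[fine b%:E]/b !lee_fin => a0 b0 _ _; move: a0 b0.
  rewrite le_eqVlt => /predU1P[<-|a0].
    by rewrite [lne 0%:E]le0_lneNy// ?addNye ?gt0_muleNy ?leNye// lte_fin invr_gt0.
  rewrite le_eqVlt => /predU1P[<-|b0].
    by rewrite [lne 0%:E]le0_lneNy// ?addeNy ?gt0_muleNy ?leNye// lte_fin invr_gt0.
  have s0 : (0 < Num.sqrt (a * b))%R by rewrite sqrtr_gt0 mulr_gt0.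
  rewrite !lne_EFin// -EFinD -EFinM lee_fin -lnM ?posrE//.
  rewrite -[X in (_ * ln X)%R](@sqr_sqrtr _ (a * b)%R); last first.
    by rewrite ltW ?mulr_gt0.
  by rewrite lnXn// -[X in (_ * X)%R]mulr_natl mulrA mulVf ?mul1r// pnatr_eq0.
Qed.

(** The defect of the arithmetic-geometric inequality is half of the square of
    the difference of the square roots, so a zero mean defect forces equality. *)
Lemma geo_mean_eq :
  1 <= \int[P]_t (geo_mean t)%:E -> {ae P, forall t, X t = Y t}.
Proof.
move=> c1.
pose D t : R := ((Num.sqrt (fine (X t)) - Num.sqrt (fine (Y t))) ^+ 2 / 2)%R.
have msqrt : measurable_fun [set: R] (@Num.sqrt R).
  by apply: continuous_measurable_fun; exact: sqrt_continuous.
have mD : measurable_fun [set: T] (EFin \o D).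
  apply/measurable_EFinP; apply: measurable_funM => //.
  apply: measurable_funX; apply: measurable_funB.
    by apply: measurableT_comp => //; exact: measurableT_comp.
  by apply: measurableT_comp => //; exact: measurableT_comp.
have D0 t : 0 <= (D t)%:E by rewrite lee_fin divr_ge0// sqr_ge0.
have Z0 t : 0 <= (geo_mean t)%:E by rewrite lee_fin sqrtr_ge0.
have hle : \int[P]_t (geo_mean t)%:E + \int[P]_t (D t)%:E <= 1.
  rewrite -ge0_integralD//; last exact: measurable_geo_mean.
  apply: (@le_trans _ _ (\int[P]_t (2^-1%:E * (X t + Y t)))).
    apply: ge0_le_integral => //.
    - by move=> t _; rewrite adde_ge0.
    - by apply: emeasurable_funD => //; exact: measurable_geo_mean.
    - by apply: emeasurable_funM => //; exact: emeasurable_funD.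
    move=> t _; rewrite /geo_mean /D; move: (X0 t) (Y0 t).
    have h2 : 0 < (2^-1 : R)%:E by rewrite lte_fin invr_gt0.
    case: (X t) => [a| |]//; case: (Y t) => [b| |]//; rewrite ?lee_fin => a0 b0.
    + rewrite -[fine a%:E]/a -[fine b%:E]/b sqrrB !sqr_sqrtr// sqrtrM//; lra.
    + by rewrite addey// gt0_muley// leey.
    + by rewrite addye// gt0_muley// leey.
    + by rewrite addye// gt0_muley// leey.
  rewrite ge0_integralZl//; last 2 first.
  - exact: emeasurable_funD.
  - by move=> t _; rewrite adde_ge0.
  rewrite ge0_integralD//.
  apply: (@le_trans _ _ (2^-1%:E * (1 + 1))).
    by apply: lee_wpmul2l; [rewrite lee_fin invr_ge0|exact: leeD].
  by rewrite -EFinD -EFinM lee_fin; lra.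
have DI0 : \int[P]_t (D t)%:E = 0.
  apply/eqP; rewrite eq_le integral_ge0// andbT.
  have := le_trans (leeD c1 (lexx (\int[P]_t (D t)%:E))) hle.
  case: (\int[P]_t (D t)%:E) => [r| |]//.
  by rewrite -EFinD !lee_fin; lra.
have Dae : ae_eq P setT (EFin \o D) (cst 0).
  apply/ae_eq_integral_abs => //; rewrite -[RHS]DI0.
  by apply: eq_integral => t _; rewrite gee0_abs//; exact: D0.
apply: filterS2 finXY Dae => t [fX fY] /(_ I) /=.
move: (X0 t) (Y0 t); rewrite /D -{1 3}(fineK fX) -{1 3}(fineK fY) !lee_fin.
move=> a0 b0 [/eqP]; rewrite mulf_eq0 sqrf_eq0 invr_eq0 pnatr_eq0 orbF subr_eq0.
by move=> /eqP ab; congr EFin; rewrite -(sqr_sqrtr a0) ab sqr_sqrtr.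
Qed.

(** Gibbs' inequality for the geometric mean [Z] holds for every [Q] with the
    same correction [E_P Z - 1], so it survives the infimum over [Q], whether
    or not that infimum is attained. *)
Lemma eq_of_expected_log_ge_inf_entropy (QQ : set (probability T R)) :
  inf_entropy QQ P \is a fin_num ->
  (forall Q, QQ Q -> inf_entropy QQ P <= expected_log Q X) ->
  (forall Q, QQ Q -> inf_entropy QQ P <= expected_log Q Y) ->
  {ae P, forall t, X t = Y t}.
Proof.
move=> fg gX gY; apply: geo_mean_eq.
rewrite leNgt; apply/negP => c1.
have c0 : 0 <= \int[P]_t (geo_mean t)%:E.
  by apply: integral_ge0 => t _; rewrite lee_fin sqrtr_ge0.
have fc : \int[P]_t (geo_mean t)%:E \is a fin_num.
  by rewrite ge0_fin_numE//; exact: lt_trans c1 (ltry _).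
suff : inf_entropy QQ P + 1 - \int[P]_t (geo_mean t)%:E <= inf_entropy QQ P.
  move: c1; rewrite -(fineK fc) -(fineK fg) -!EFinD lee_fin lte_fin; lra.
apply: le_ereal_inf_tmp => _ [Q QQQ <-].
have [->|H] := eqVneq (rel_entropy Q P) +oo; first exact: leey.
have {}H : rel_entropy Q P < +oo by rewrite ltey.
have := @gibbs _ _ _ Q P _ measurable_geo_mean.
move=> /(_ (fun t => ltac:(by rewrite lee_fin sqrtr_ge0)) (lt_trans c1 (ltry _))).
have := expected_log_geo_mean H.
move=> /(_ (fine (inf_entropy QQ P))); rewrite fineK//.
move=> /(_ (gX _ QQQ) (gY _ QQQ)).
move=> h1 h2; rewrite leeBlDr//; apply: le_trans h2.
exact: leeD.
Qed.

End uniqueness.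

(** * Completeness of L1 along fast Cauchy sequences *)

Section fast_cauchy.
Context d (T : measurableType d) (R : realType) (mu : {measure set T -> \bar R}).
Variables (x : nat -> T -> R) (c : R).
Hypothesis ix : forall k, mu.-integrable [set: T] (EFin \o x k).
Hypothesis dx : forall k,
  \int[mu]_t (`|x k t - x k.+1 t|)%:E <= (c / (2 ^ k.+1)%:R)%:E.

Let tail n t : \bar R := \sum_(0 <= k <oo) (`|x (k + n)%N t - x (k + n).+1 t|)%:E.

Let mx k : measurable_fun [set: T] (x k).
Proof. by apply/measurable_EFinP; exact: measurable_int (ix k). Qed.

Let mdist (f g : T -> R) : measurable_fun [set: T] f -> measurable_fun [set: T] g ->
  measurable_fun [set: T] (fun t => (`|f t - g t|)%:E).
Proof.
move=> mf mg; apply/measurable_EFinP; apply: measurableT_comp => //.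
exact: measurable_funB.
Qed.

Let mtail n : measurable_fun [set: T] (tail n).
Proof. by apply: ge0_emeasurable_sum => // k _ _; exact: mdist. Qed.

Let tail_ge0 n t : 0 <= tail n t.
Proof. by apply: nneseries_ge0 => k _ _; rewrite lee_fin. Qed.

Let int_tail n : \int[mu]_t tail n t <= (c / 2 ^+ n)%:E.
Proof.
rewrite integral_nneseries//; first last.
- by move=> k; exact: mdist.
- rewrite -(cvg_lim _ (@cvg_geometric_eseries_half R c n))//.
  apply: lee_nneseries => [k _ _|k _].
    by apply: integral_ge0 => t _; rewrite lee_fin.
  by rewrite addnS; exact: dx.
Qed.

Let dist_le_tail n m t : (`|x n t - x (m + n)%N t|)%:E <= tail n t.
Proof.
apply: (@le_trans _ _ (\sum_(0 <= k < m) (`|x (k + n)%N t - x (k + n).+1 t|)%:E)).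
  elim: m => [|m IH]; first by rewrite big_geq// add0n subrr normr0.
  rewrite big_nat_recr//=; apply: le_trans (leeD IH (lexx _)).
  by rewrite -EFinD lee_fin; exact: ler_distD.
by apply: nneseries_lim_ge => k _ _; rewrite lee_fin.
Qed.

Let tail_fin_cvg t : tail 0 t < +oo -> cvgn (x ^~ t).
Proof.
move=> ty.
have ft : tail 0 t \is a fin_num by rewrite ge0_fin_numE.
have h : cvgn [normed series (telescope (x ^~ t))].
  apply: nondecreasing_is_cvgn.
    by apply: nondecreasing_series => k _ _ /=.
  exists (fine (tail 0 t)) => _ [m _ <-]; rewrite -lee_fin fineK//.
  rewrite /series/= -sumEFin.
  apply: le_trans (nneseries_lim_ge m _); last by move=> k _ _; rewrite lee_fin.
  by apply: lee_sum => k _; rewrite addn0 lee_fin distrC.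
have /cvg_ex[l ul] := normed_cvg h.
apply/cvg_ex; exists (x 0%N t + l)%R.
have -> : (x ^~ t) = (fun n => x 0%N t + series (telescope (x ^~ t)) n)%R.
  by apply/funext => n; rewrite -eq_sum_telescope.
by apply: cvgD => //; exact: cvg_cst.
Qed.

(** The sum of the increments after step [n] dominates all later deviations from
    [x n], and has integral at most [c / 2^n]; where the full sum is finite the
    sequence converges. The limit is taken as a limit superior so that it is
    measurable. *)
Lemma fast_cauchy_cvg : exists y : T -> R,
  [/\ mu.-integrable [set: T] (EFin \o y),
      {ae mu, forall t, x n t @[n --> \oo] --> y t}
    & forall n, \int[mu]_t (`|x n t - y t|)%:E <= (c / 2 ^+ n)%:E].
Proof.
pose y t := fine (limn_esup (fun n => (x n t)%:E)).
have my : measurable_fun [set: T] y.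
  apply: measurableT_comp => //; apply: measurable_fun_limn_esup => n.
  exact/measurable_EFinP.
have xy : {ae mu, forall t, x n t @[n --> \oo] --> y t}.
  have i0 : mu.-integrable [set: T] (tail 0).
    apply/integrableP; split => //.
    under eq_integral do rewrite gee0_abs//.
    by apply: le_lt_trans (int_tail 0) (ltry _).
  have := integrable_ae measurableT i0.
  apply: filterS => t /(_ I); rewrite ge0_fin_numE// => /tail_fin_cvg /cvg_ex[l ul].
  rewrite /y; have ul' : (x n t)%:E @[n --> \oo] --> l%:E.
    by apply: cvg_EFin => //; exact: nearW.
  by rewrite (cvg_limn_einf_sup ul').2.
have dxy n : \int[mu]_t (`|x n t - y t|)%:E <= (c / 2 ^+ n)%:E.
  apply: le_trans (int_tail n).
  apply: ae_ge0_le_integral => //; [exact: mdist|].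
  apply: filterS xy => t ut _.
  have [fy|] := boolP (tail n t \is a fin_num); last first.
    by rewrite ge0_fin_numE// -leNgt leye_eq => /eqP ->; rewrite leey.
  rewrite -(fineK fy) lee_fin.
  have h : (`|x n t - x m t|)%R @[m --> \oo] --> (`|x n t - y t|)%R.
    by apply: cvg_norm; apply: cvgB => //; exact: cvg_cst.
  apply: (cvgr_to_le h); exists n => // m /= nm.
  rewrite -lee_fin fineK// -(subnK nm); exact: dist_le_tail.
exists y; split => //.
apply/integrableP; split; first exact/measurable_EFinP.
apply: (@le_lt_trans _ _ (\int[mu]_t ((`|x 0%N t|)%:E + (`|x 0%N t - y t|)%:E))).
  apply: ge0_le_integral => //.
  - by apply: measurableT_comp => //; exact/measurable_EFinP.
  - apply: emeasurable_funD; last exact: mdist.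
    by apply/measurable_EFinP; exact: measurableT_comp.
  - move=> t _; rewrite abse_EFin -EFinD lee_fin.
    have := ler_normB (x 0%N t) (x 0%N t - y t)%R.
    by rewrite opprB addrCA subrr addr0.
rewrite ge0_integralD//; first last.
- exact: mdist.
- by apply/measurable_EFinP; exact: measurableT_comp.
apply: lte_add_pinfty.
  exact: (elimT (integrableP _ _ _) (ix 0%N)).2.
exact: le_lt_trans (dxy 0%N) (ltry _).
Qed.

End fast_cauchy.

(** * Maximizing the mean log-density over a polar set *)

(** Logarithms of the [Q]-densities in the polar of [F]. When [F] is the set of
    e-variables, these are the log-densities of the effective nulls that have a
    positive density with respect to [Q]. *)
Definition log_polar d (T : measurableType d) (R : realType)
    (Q : probability T R) (F : set (T -> \bar R)) : set (T -> R) :=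
  [set x | measurable_fun [set: T] x /\
    forall f, F f -> \int[Q]_t (f t * (expR (x t))%:E) <= 1].

Section log_polar.
Context d (T : measurableType d) (R : realType).
Variables (Q : probability T R) (F : set (T -> \bar R)).
Hypothesis mF : forall f, F f -> measurable_fun [set: T] f.
Hypothesis F0 : forall f, F f -> forall t, 0 <= f t.
Hypothesis F1 : F (cst 1).

Let mexp (x : T -> R) : measurable_fun [set: T] x ->
  measurable_fun [set: T] (fun t => (expR (x t))%:E).
Proof. by move=> mx; apply/measurable_EFinP; exact: measurableT_comp. Qed.

Lemma Rintegral_cst_probability (r : R) : (\int[Q]_t cst r t = r)%R.
Proof.
rewrite Rintegral_cst// (_ : fine _ = 1%R) ?mulr1//.
exact: (congr1 fine (probability_setT Q)).
Qed.

Lemma measurable_log_mean (x y : T -> R) :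
  measurable_fun [set: T] x -> measurable_fun [set: T] y ->
  measurable_fun [set: T] (fun t => log_mean (x t) (y t)).
Proof.
move=> mx my; apply: measurableT_comp => //; apply: measurable_funM => //.
by apply: measurable_funD; exact: measurableT_comp.
Qed.

Lemma log_polar_mean (x y : T -> R) : log_polar Q F x -> log_polar Q F y ->
  log_polar Q F (fun t => log_mean (x t) (y t)).
Proof.
move=> [mx Fx] [my Fy]; split; first exact: measurable_log_mean.
move=> f Ff.
have mfx : measurable_fun [set: T] (fun t => f t * (expR (x t))%:E).
  by apply: emeasurable_funM; [exact: mF|exact: mexp].
have mfy : measurable_fun [set: T] (fun t => f t * (expR (y t))%:E).
  by apply: emeasurable_funM; [exact: mF|exact: mexp].
have fx0 t : 0 <= f t * (expR (x t))%:E.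
  by rewrite mule_ge0 ?F0// lee_fin expR_ge0.
have fy0 t : 0 <= f t * (expR (y t))%:E.
  by rewrite mule_ge0 ?F0// lee_fin expR_ge0.
under eq_integral => t _.
  rewrite expR_log_mean mulrC EFinM muleCA EFinD ge0_muleDr; last 2 first.
  - by rewrite lee_fin expR_ge0.
  - by rewrite lee_fin expR_ge0.
  over.
rewrite ge0_integralZl//; last 2 first.
- exact: emeasurable_funD.
- by move=> t _; rewrite adde_ge0.
rewrite ge0_integralD//.
apply: (@le_trans _ _ (2^-1%:E * (1 + 1))).
  by apply: lee_wpmul2l; [rewrite lee_fin invr_ge0|apply: leeD; [exact: Fx|exact: Fy]].
by rewrite -EFinD -EFinM lee_fin; lra.
Qed.

Lemma integrable_log_mean (x y : T -> R) :
  Q.-integrable [set: T] (EFin \o x) -> Q.-integrable [set: T] (EFin \o y) ->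
  Q.-integrable [set: T] (EFin \o (fun t => log_mean (x t) (y t))).
Proof.
move=> ix iy.
have iab := integrableD measurableT (integrable_abse ix) (integrable_abse iy).
apply: le_integrable iab => //.
  apply/measurable_EFinP; apply: measurable_log_mean.
    by apply/measurable_EFinP; exact: measurable_int ix.
  by apply/measurable_EFinP; exact: measurable_int iy.
move=> t _ /=; rewrite lee_fin [leRHS]ger0_norm ?addr_ge0//.
have hx := ler_norm (x t); have hx' := ler_norm (- x t)%R.
have hy := ler_norm (y t); have hy' := ler_norm (- y t)%R.
rewrite !normrN in hx' hy'.
move: hx hx' hy hy' (normr_ge0 (x t)) (normr_ge0 (y t)).
move: (x t) (y t) (`|x t|)%R (`|y t|)%R => a b a' b' ? ? ? ? ? ?.
rewrite ler_norml; apply/andP; split.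
- rewrite -[leLHS]expRK ler_ln ?posrE ?expR_gt0//; last first.
    by rewrite divr_gt0// addr_gt0 ?expR_gt0.
  have : (expR (- (a' + b')) <= expR a)%R by rewrite ler_expR; lra.
  have : (expR (- (a' + b')) <= expR b)%R by rewrite ler_expR; lra.
  lra.
- rewrite -[leRHS]expRK ler_ln ?posrE ?expR_gt0//; last first.
    by rewrite divr_gt0// addr_gt0 ?expR_gt0.
  have : (expR a <= expR (a' + b'))%R by rewrite ler_expR; lra.
  have : (expR b <= expR (a' + b'))%R by rewrite ler_expR; lra.
  lra.
Qed.

Lemma log_polar_Rintegral_le0 (x : T -> R) : log_polar Q F x ->
  Q.-integrable [set: T] (EFin \o x) -> (\int[Q]_t x t <= 0)%R.
Proof.
move=> [mx Fx] ix; have := Fx _ F1; under eq_integral do rewrite mul1e.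
move=> ex1.
have iex : Q.-integrable [set: T] (fun t => (expR (x t))%:E).
  apply/integrableP; split; first exact: mexp.
  under eq_integral do rewrite gee0_abs ?lee_fin ?expR_ge0//.
  exact: le_lt_trans ex1 (ltry _).
have i1 : Q.-integrable [set: T] (EFin \o cst 1%R).
  exact: finite_measure_integrable_cst.
have := @le_Rintegral _ _ _ Q setT x (fun t => expR (x t) - 1)%R measurableT ix.
move=> /(_ (integrableB measurableT iex i1)) h.
apply: le_trans (h _) _; first by move=> t _; have := expR_ge1Dx (x t); lra.
rewrite RintegralB// Rintegral_cst_probability subr_le0.
by rewrite -lee_fin /Rintegral fineK//; exact: integrable_fin_num.
Qed.

(** Fatou's lemma applies because the members of [F] are nonnegative; where
    [f t = +oo] the products are constantly [+oo], as [e^x] is positive. *)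
Lemma log_polar_cvg (u : nat -> T -> R) (y : T -> R) :
  (forall n, log_polar Q F (u n)) -> measurable_fun [set: T] y ->
  {ae Q, forall t, u n t @[n --> \oo] --> y t} -> log_polar Q F y.
Proof.
move=> Fu my uy; split => // f Ff.
have mfu n : measurable_fun [set: T] (fun t => f t * (expR (u n t))%:E).
  by apply: emeasurable_funM; [exact: mF|apply: mexp; exact: (Fu n).1].
have fu0 n t : [set: T] t -> 0 <= f t * (expR (u n t))%:E.
  by move=> _; rewrite mule_ge0 ?F0// lee_fin expR_ge0.
have := fatou Q measurableT mfu fu0.
have -> : \int[Q]_t limn_einf (fun n => f t * (expR (u n t))%:E) =
    \int[Q]_t (f t * (expR (y t))%:E).
  apply: ae_eq_integral => //.
  - apply: measurableT_comp => //.
    apply: measurable_fun_limn_esup => n.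
    by apply: measurableT_comp => //; exact: mfu.
  - by apply: emeasurable_funM; [exact: mF|exact: mexp].
  - apply: filterS uy => t ut _.
    have eut : (expR (u n t))%:E @[n --> \oo] --> (expR (y t))%:E.
      apply: cvg_EFin; first exact: nearW.
      by apply: continuous_cvg => //; exact: continuous_expR.
    have fut : f t * (expR (u n t))%:E @[n --> \oo] --> f t * (expR (y t))%:E.
      have [ft|] := boolP (f t \is a fin_num); first exact: cvgeZl.
      rewrite ge0_fin_numE ?F0// -leNgt leye_eq => /eqP ->.
      under eq_fun do rewrite gt0_mulye ?lte_fin ?expR_gt0//.
      by rewrite gt0_mulye ?lte_fin ?expR_gt0//; exact: cvg_cst.
    by rewrite (cvg_limn_einf_sup fut).1.
move=> /le_trans; apply; rewrite limn_einf_lim.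
apply: lime_le; first exact: is_cvg_einfs.
apply: nearW => n; apply: (@le_trans _ _ (\int[Q]_t (f t * (expR (u n t))%:E))).
  by apply: ereal_inf_lbound; exists n => /=.
exact: (Fu n).2.
Qed.

(** The log-mean of two near-maximizers lies in the set and therefore cannot do
    better than the supremum, so its gain over the average of the two, and with
    it their [L1] distance, is small. *)
Lemma log_polar_maximizer (x0 : T -> R) :
  log_polar Q F x0 -> Q.-integrable [set: T] (EFin \o x0) ->
  exists x, [/\ log_polar Q F x, Q.-integrable [set: T] (EFin \o x)
    & forall y, log_polar Q F y -> Q.-integrable [set: T] (EFin \o y) ->
        (\int[Q]_t y t <= \int[Q]_t x t)%R].
Proof.
move=> Fx0 ix0.
pose D : set (T -> R) :=
  [set x | log_polar Q F x /\ Q.-integrable [set: T] (EFin \o x)].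
pose E : set R := [set (\int[Q]_t x t)%R | x in D].
have supE : has_sup E.
  split; first by exists (\int[Q]_t x0 t)%R, x0.
  by exists 0%R => _ [x [Fx ix] <-]; exact: log_polar_Rintegral_le0.
have le_sup y : D y -> (\int[Q]_t y t <= sup E)%R.
  by move=> Dy; apply: sup_upper_bound => //; exists y.
have /choice[u uP] k : exists x, D x /\ (sup E - (4 ^+ k)^-1 < \int[Q]_t x t)%R.
  have e0 : (0 < (4 ^+ k)^-1 :> R)%R by rewrite invr_gt0 exprn_gt0.
  by have [_ [x Dx <-] h] := sup_adherent e0 supE; exists x.
have iu k := (uP k).1.2.
have Fu k := (uP k).1.1.
have du k : \int[Q]_t (`|u k t - u k.+1 t|)%:E <= (26 / (2 ^ k.+1)%:R)%:E.
  have D1 : D (fun t => log_mean (u k t) (u k.+1 t)).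
    by split; [exact: log_polar_mean|exact: integrable_log_mean].
  have il := D1.2.
  (* This e balances the two terms of the distance bound: the Jensen gap has
     mean at most e ^ 2, so the bound becomes 13 * e = 26 / 2 ^ (k + 1). *)
  pose e : R := ((2 ^+ k)^-1)%R.
  have e01 : (0 < e <= 1)%R.
    by rewrite invr_gt0 exprn_gt0//= invf_le1 ?exprn_gt0// exprn_ege1//; lra.
  have e0 : (0 < e)%R by case/andP : e01.
  have e4 : ((4 ^+ k)^-1 = e * e :> R)%R.
    by rewrite /e -invfM -exprMn; congr ((_ ^+ _)^-1)%R; ring.
  have e4' : ((4 ^+ k.+1)^-1 <= e * e :> R)%R.
    by rewrite exprS invfM e4; have := mulr_gt0 e0 e0; lra.
  have iuu : Q.-integrable setT (EFin \o (fun t => (u k t + u k.+1 t) / 2)%R).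
    have := integrableZl measurableT 2^-1 (integrableD measurableT (iu k) (iu k.+1)).
    by apply: eq_integrable => // t _ /=; rewrite -EFinD -EFinM mulrC.
  have ih := integrableB measurableT il iuu.
  have ic := integrableZl measurableT (12 / e) ih.
  have ie : Q.-integrable setT (EFin \o cst e) by exact: finite_measure_integrable_cst.
  have idist : Q.-integrable setT (EFin \o (fun t => `|u k t - u k.+1 t|%R)).
    by have := integrable_abse (integrableB measurableT (iu k) (iu k.+1)).
  rewrite -[leLHS]fineK; last exact: integrable_fin_num.
  rewrite lee_fin -/(Rintegral Q setT _).
  apply: (@le_trans _ _ (\int[Q]_t (e + 12 / e *
      (log_mean (u k t) (u k.+1 t) - (u k t + u k.+1 t) / 2)))%R).
    apply: le_Rintegral => //; first exact: (integrableD measurableT ie ic).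
    by move=> t _; exact: dist_le_log_mean.
  rewrite RintegralD// RintegralZl// RintegralB// Rintegral_cst_probability.
  have -> : (\int[Q]_t ((u k t + u k.+1 t) / 2) =
      (\int[Q]_t u k t + \int[Q]_t u k.+1 t) / 2)%R.
    have iD : Q.-integrable setT (EFin \o (fun t => u k t + u k.+1 t)%R).
      exact: (integrableD measurableT (iu k) (iu k.+1)).
    by rewrite RintegralZr// RintegralD.
  have hle : (\int[Q]_t log_mean (u k t) (u k.+1 t) -
      (\int[Q]_t u k t + \int[Q]_t u k.+1 t) / 2 <= e * e)%R.
    have := le_sup _ D1; have := (uP k).2; have := (uP k.+1).2.
    rewrite e4; move: e4'; lra.
  apply: (@le_trans _ _ (e + 12 / e * (e * e))%R).
    by rewrite lerD2l ler_wpM2l// divr_ge0// ltW.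
  have -> : (e + 12 / e * (e * e) = 13 * e)%R by field; rewrite gt_eqF.
  have -> : (26 / (2 ^ k.+1)%:R = 13 * e)%R.
    rewrite /e natrX exprS; field; rewrite gt_eqF// exprn_gt0//.
  exact: lexx.
have [y [iy uy dy]] := fast_cauchy_cvg iu du.
have my : measurable_fun [set: T] y.
  by apply/measurable_EFinP; exact: measurable_int iy.
exists y; split => //; first exact: log_polar_cvg uy.
move=> z Fz iz; apply: (le_trans (le_sup z _)); first by split.
have step n : (sup E - \int[Q]_t y t <= 27 * (2^-1) ^+ n)%R.
  have idist : Q.-integrable setT (EFin \o (fun t => `|u n t - y t|%R)).
    by have := integrable_abse (integrableB measurableT (iu n) iy).
  have h1 : (\int[Q]_t u n t - \int[Q]_t y t <= 26 / 2 ^+ n)%R.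
    rewrite -RintegralB//.
    apply: (@le_trans _ _ (\int[Q]_t `|u n t - y t|)%R).
      apply: le_Rintegral => //; first exact: (integrableB measurableT (iu n) iy).
      by move=> t _; exact: ler_norm.
    by rewrite -lee_fin /Rintegral fineK//; exact: integrable_fin_num.
  have h2 : ((4 ^+ n)^-1 <= 2^-1 ^+ n :> R)%R.
    by rewrite -exprVn; apply: lerXn2r; rewrite ?nnegrE ?invr_ge0//; lra.
  have := (uP n).2; move: h1; rewrite -exprVn; lra.
rewrite -subr_le0.
have h : (27 * (2^-1) ^+ n)%R @[n --> \oo] --> (27 * 0 : R)%R.
  apply: cvgM; first exact: cvg_cst.
  by apply: cvg_expr; rewrite ger0_norm ?invr_ge0//; lra.
rewrite mulr0 in h.
by apply: (cvgr_to_ge h); apply: nearW => n; exact: step.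
Qed.

End log_polar.

(** * Attainment of the minimal entropy *)

(** The proofs are arguments so that they can be found by the canonical measure
    structures declared below. *)
Definition measure_with_density d (T : measurableType d) (R : realType)
    (Q : {measure set T -> \bar R}) (f : T -> \bar R)
    & measurable_fun [set: T] f & (forall t, 0 <= f t) & \int[Q]_t f t < +oo :=
  fun A => \int[Q]_(t in A) f t.

Section measure_with_density.
Context d (T : measurableType d) (R : realType).
Variables (Q : {measure set T -> \bar R}) (f : T -> \bar R).
Hypothesis mf : measurable_fun [set: T] f.
Hypothesis f0 : forall t, 0 <= f t.
Hypothesis fy : \int[Q]_t f t < +oo.

Local Notation P := (measure_with_density mf f0 fy).

Let P0 : P set0 = 0. Proof. exact: integral_set0. Qed.

Let P_ge0 A : 0 <= P A. Proof. exact: integral_ge0. Qed.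

Let P_sigma : semi_sigma_additive P.
Proof. exact: semi_sigma_additive_nng_induced. Qed.

HB.instance Definition _ := isMeasure.Build _ T R P P0 P_ge0 P_sigma.

Let P_fin : fin_num_fun P.
Proof.
move=> A mA; rewrite ge0_fin_numE//; apply: le_lt_trans fy.
by apply: ge0_subset_integral.
Qed.

HB.instance Definition _ := @Measure_isFinite.Build _ _ _ P P_fin.

End measure_with_density.

Lemma rel_entropy_expR_density d (T : measurableType d) (R : realType)
    (Q : probability T R) (P : {finite_measure set T -> \bar R}) (x : T -> R) :
  Q.-integrable [set: T] (EFin \o x) ->
  (forall A, measurable A -> P A = \int[Q]_(t in A) (expR (x t))%:E) ->
  rel_entropy Q P = - \int[Q]_t (x t)%:E.
Proof.
move=> ix PE.
have mx : measurable_fun [set: T] x.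
  by apply/measurable_EFinP; exact: measurable_int ix.
have mex : measurable_fun [set: T] (fun t => (expR (x t))%:E).
  by apply/measurable_EFinP; exact: measurableT_comp.
have mnx : measurable_fun [set: T] (fun t => (expR (- x t))%:E).
  by apply/measurable_EFinP; do 2 apply: measurableT_comp => //.
have QE A : measurable A -> Q A = \int[P]_(t in A) (expR (- x t))%:E.
  move=> mA; rewrite integral_mkcond.
  rewrite (@ge0_integral_density _ _ _ P Q (fun t => (expR (x t))%:E))//.
  - rewrite (eq_integral (EFin \o \1_A)) ?integral_indic ?setIT// => t _.
    rewrite patchE /= indicE; case: ifPn => _; last by rewrite mul0e.
    by rewrite -EFinM mulrC expRxMexpNx_1.
  - by apply/(measurable_restrictT _ mA); exact: measurable_funTS.
  - by move=> t; rewrite patchE; case: ifPn => // _; exact: expR_ge0.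
have QP : Q `<< P.
  apply/null_content_dominatesP => A mA PA0.
  by rewrite QE// null_set_integral//; exact: measurable_funTS.
have dE : {ae Q, forall t, density Q P t = (expR (- x t))%:E}.
  suff : ae_eq P setT (density Q P) (fun t => (expR (- x t))%:E).
    move=> /(null_dominates_ae_eq measurableT QP).
    by apply: filterS => t; exact.
  apply: integral_ae_eq => //; first exact: Radon_Nikodym_integrable.
  move=> A _ mA; rewrite -QE//.
  by rewrite -Radon_Nikodym_integral.
rewrite /rel_entropy asboolT// /expected_log -integralN/=; last first.
  exact: integrable_add_def.
apply: ae_eq_integral => //.
- apply: measurableT_comp; first exact: measurable_lne.
  by apply: (measurable_int P); exact: Radon_Nikodym_integrable.
- by apply/measurable_EFinP; exact: measurableT_comp.
- by apply: filterS dE => t -> _; rewrite lne_EFin ?expR_gt0// expRK.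
Qed.

(** Every effective null of finite entropy yields a point of the polar set of
    e-variables, and the maximizer over that set yields an effective null. *)
Lemma min_entropy_attained_effective_null d (T : measurableType d) (R : realType)
    (PP : set (probability T R)) (Q : probability T R) :
  effective_null PP !=set0 -> min_entropy_attained PP Q.
Proof.
move=> [P0 P0eff].
have [[P1 P1eff H1]|noH] := pselect (exists2 P, effective_null PP P &
    rel_entropy Q P < +oo); last first.
  exists P0 => // P' P'eff.
  have -> : rel_entropy Q P' = +oo; last exact: leey.
  by apply/eqP; rewrite -leye_eq leNgt; apply/negP => H; apply: noH; exists P'.
have mE X : e_variable PP X -> measurable_fun [set: T] X by case.
have E0 X : e_variable PP X -> forall t, 0 <= X t by case.
have E1 : e_variable PP (cst 1).
  by split => // P _; rewrite integral_cst// mul1e probability_le1.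
have polar P : effective_null PP P -> rel_entropy Q P < +oo -> exists x,
    [/\ log_polar Q (e_variable PP) x, Q.-integrable [set: T] (EFin \o x)
      & rel_entropy Q P = - (\int[Q]_t x t)%R%:E].
  move=> Peff H; have [x [ix HE dx]] := neg_log_density H.
  exists x; split => //; last first.
    by rewrite HE /Rintegral fineK//; exact: integrable_fin_num.
  split; first by apply/measurable_EFinP; exact: measurable_int ix.
  by move=> X EX; apply: le_trans (dx _ (mE _ EX) (E0 _ EX)) _; exact: Peff.
have [x1 [Fx1 ix1 _]] := polar _ P1eff H1.
have [x [Fx ix xmax]] := log_polar_maximizer mE E0 E1 Fx1 ix1.
have [mx Ex] := Fx.
have mex : measurable_fun [set: T] (fun t => (expR (x t))%:E).
  by apply/measurable_EFinP; exact: measurableT_comp.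
have ex0 t : 0 <= (expR (x t))%:E by rewrite lee_fin expR_ge0.
have exy : \int[Q]_t (expR (x t))%:E < +oo.
  have := Ex _ E1; under eq_integral do rewrite mul1e.
  by move=> h; exact: le_lt_trans h (ltry _).
pose P : {finite_measure set T -> \bar R} := measure_with_density mex ex0 exy.
have PE : rel_entropy Q P = - (\int[Q]_t x t)%R%:E.
  rewrite (rel_entropy_expR_density (x := x))//.
  by rewrite /Rintegral fineK//; exact: integrable_fin_num.
exists P.
  move=> X EX.
  rewrite (ge0_integral_density (Q := Q) (f := fun t => (expR (x t))%:E))//.
  - exact: Ex.
  - exact: mE.
  - exact: E0.
move=> P' P'eff; have [->|H] := eqVneq (rel_entropy Q P') +oo; first exact: leey.
have {}H : rel_entropy Q P' < +oo by rewrite ltey.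
have [y [Fy iy ->]] := polar _ P'eff H.
by rewrite PE leeN2 lee_fin; exact: xmax.
Qed.

(** * Strong duality *)

Theorem theorem4p10 (d : measure_display) (T : measurableType d) (R : realType)
    (PP QQ : set (probability T R))
    (Ps : {finite_measure set T -> \bar R}) (Qs : probability T R)
    (Xs : T -> \bar R)
    (PP_nonempty : PP !=set0)
    (QQ_nonempty : QQ !=set0)
    (QQ_convex : convex_proba QQ)
    (PsQs_jipr : is_jipr PP QQ Ps Qs)
    (Xs_version : density_version Qs Ps Xs)
    (Xs_evar : e_variable PP Xs)
    (Xs_bound : forall Q : probability T R, QQ Q ->
       inf_entropy QQ Ps <= expected_log Q Xs) :
  [/\ is_grow PP QQ Xs,
      [/\ grow_value PP QQ = inf_expected_log QQ Xs,
          inf_expected_log QQ Xs = inf_entropy QQ Ps,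
          (forall Q : probability T R, QQ Q -> min_entropy_attained PP Q)
        & inf_entropy QQ Ps = ereal_inf [set min_entropy PP Q | Q in QQ]]
    & mem_proba QQ Qs ->
      forall X : T -> \bar R, is_grow PP QQ X -> {ae Ps, forall x, X x = Xs x}].
Proof.
have [Ps_eff _ Ps_fin _ _] := PsQs_jipr.
have weak X P Q : e_variable PP X -> effective_null PP P ->
    expected_log Q X <= rel_entropy Q P.
  move=> EX Peff; have [mX X0 _] := EX.
  by apply: expected_log_le_rel_entropy => //; exact: Peff.
have inf_le X Q : QQ Q -> inf_expected_log QQ X <= expected_log Q X.
  by move=> QQQ; apply: ereal_inf_lbound; exists Q.
have upper X : e_variable PP X -> inf_expected_log QQ X <= inf_entropy QQ Ps.
  move=> EX; apply: le_ereal_inf_tmp => _ [Q QQQ <-].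
  exact: le_trans (inf_le _ _ QQQ) (weak _ _ _ EX Ps_eff).
have XsE : inf_expected_log QQ Xs = inf_entropy QQ Ps.
  apply/eqP; rewrite eq_le upper//=.
  by apply: le_ereal_inf_tmp => _ [Q QQQ <-]; exact: Xs_bound.
have GE : grow_value PP QQ = inf_expected_log QQ Xs.
  apply/eqP; rewrite eq_le; apply/andP; split.
    by apply: ge_ereal_sup => _ [X EX <-]; rewrite XsE; exact: upper.
  by apply: ereal_sup_ubound; exists Xs.
split; first by split.
- split => //.
  + by move=> Q _; apply: min_entropy_attained_effective_null; exists Ps.
  + apply/eqP; rewrite eq_le; apply/andP; split.
      apply: le_ereal_inf_tmp => _ [Q QQQ <-].
      apply: le_ereal_inf_tmp => _ [P Peff <-].
      exact: le_trans (Xs_bound _ QQQ) (weak _ _ _ Xs_evar Peff).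
    apply: le_ereal_inf_tmp => _ [Q QQQ <-].
    apply: (@le_trans _ _ (min_entropy PP Q)).
      by apply: ereal_inf_lbound; exists Q.
    by apply: ereal_inf_lbound; exists Ps.
- move=> _ X [EX XG]; have [mX X0 _] := EX; have [mXs Xs0 _] := Xs_evar.
  have E1 : e_variable PP (cst 1).
    by split => // P _; rewrite integral_cst// mul1e probability_le1.
  (* The constant e-variable 1 has expected logarithm 0. *)
  have G0 : 0 <= inf_entropy QQ Ps.
    apply: le_trans (upper _ E1); apply: le_ereal_inf_tmp => _ [Q QQQ <-].
    by apply: integral_ge0 => t _; rewrite lne_ge0.
  apply: (eq_of_expected_log_ge_inf_entropy mX mXs X0 Xs0
    (Ps_eff _ EX) (Ps_eff _ Xs_evar) _ _ Xs_bound); first by rewrite ge0_fin_numE.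
  by move=> Q QQQ; rewrite -XsE -GE -XG; exact: inf_le.
Qed.
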